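(* Let $X$ be an unbounded metric space. If the asymptotic dimension $\mathrm{asdim}(X)$ is finite, then $\mathrm{asdim}(X)=\dim^{large}_{scale}(X)$. Likewise, if the minor asymptotic dimension $\mathrm{ad}(X)$ is finite, then $\mathrm{ad}(X)=\dim^{large}_{scale}(X)$. Here $\dim^{large}_{scale}$ denotes the large scale dimension.
   Context: Let $(X,d)$ be a metric space. For points, $x_k\to\infty$ means $d(x_k,x_0)\to\infty$ for some (hence every) $x_0\in X$. A function $f:X\to[0,\infty]$ is coarsely proper if $f(x_k)\to\infty$ whenever $x_k\to\infty$. Families of subsets of $X$ need not cover $X$. For a family $\mathcal U$ of subsets of $X$, $L_{\mathcal U}(x)=\sup_{U\in\mathcal U}\mathrm{dist}(x,X\setminus U)\in[0,\infty]$, with $\mathrm{dist}(x,\emptyset)=\infty$ and the supremum over the empty family equal to $0$. The Lebesgue number of $\mathcal U$ is $L(\mathcal U,X)=\inf_{x\in X}L_{\mathcal U}(x)$. The family $\mathcal U$ is coarse if $L_{\mathcal U}$ is coarsely proper. The multiplicity of $\mathcal U$ is the supremum over $x\in X$ of the number of elements of $\mathcal U$ containing $x$. $\mathcal V$ refines $\mathcal U$ if each element of $\mathcal V$ is contained in some element of $\mathcal U$. For $A\subset X$ and a family $\mathcal U$ in $X$, $L^n(\mathcal U,A)$ is the supremum of all $t\in[0,\infty]$ such that the family $\mathcal U|_A=\{U\cap A\}_{U\in\mathcal U}$ in the metric space $A$ has a refinement (by subsets of $A$) of multiplicity at most $n+1$ and Lebesgue number (computed in the metric space $A$) at least $t$.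 Asymptotic dimension $\mathrm{asdim}(X)$ (respectively, minor asymptotic dimension $\mathrm{ad}(X)$): the smallest integer $n\ge0$ such that $L^n(\mathcal U_k,X)\to\infty$ for every sequence of arbitrary covers (respectively, finite covers) $\mathcal U_k$ of $X$ with $L(\mathcal U_k,X)\to\infty$. Large scale dimension $\dim^{large}_{scale}(X)$: the smallest integer $n\ge-1$ such that for every finite coarse family $\mathcal U$ in $X$ the function $A\mapsto L^n(\mathcal U,A)$ is coarsely proper on nonempty bounded subsets of $X$, i.e. $L^n(\mathcal U,A_k)\to\infty$ whenever $A_k$ are nonempty bounded subsets with $\mathrm{dist}(x_0,A_k)\to\infty$. Each dimension is $\infty$ if no such integer exists. *)

(* Defs.v *)
From HB Require Import structures.
From mathcomp Require Import all_boot all_order all_algebra.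
From mathcomp Require Import all_classical all_reals all_analysis.

Set Implicit Arguments.
Unset Strict Implicit.
Unset Printing Implicit Defensive.

Import Order.TTheory GRing.Theory Num.Theory.
Import numFieldNormedType.Exports.

Local Open Scope classical_set_scope.
Local Open Scope ring_scope.

(* Supremum taken in [0, +oo]: unlike [ereal_sup], its value on [set0] is 0. *)
Definition sup_ge0 (R : realType) (S : set (\bar R)) : \bar R :=
  maxe 0%E (ereal_sup S).

Section Families.
Variables (R : realType) (X : metricType R).
Implicit Types (x y : X) (A B : set X) (U V : set (set X)).

(* [ereal_inf set0 = +oo], so the distance to the empty set is +oo. *)
Definition dist_set x B : \bar R := ereal_inf [set (mdist x y)%:E | y in B].

Definition is_bounded A : Prop :=
  exists M : R, forall x y, A x -> A y -> mdist x y <= M.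

Definition to_infinity (x_ : nat -> X) : Prop :=
  exists x0, mdist (x_ k) x0 @[k --> \oo] --> +oo.

Definition coarsely_proper (f : X -> \bar R) : Prop :=
  forall x_ : nat -> X, to_infinity x_ -> f (x_ k) @[k --> \oo] --> +oo%E.

(* In the next three definitions the set [A], with the induced metric, is the
   ambient metric space and [U] is meant to be a family of subsets of [A];
   families in [X] itself are handled with [A = setT]. *)
Definition lebesgue_fun U A x : \bar R :=
  sup_ge0 [set dist_set x (A `\` B) | B in U].

Definition lebesgue_number U A : \bar R :=
  ereal_inf [set lebesgue_fun U A x | x in A].

Definition multiplicity U A : \bar R :=
  sup_ge0 [set counting [set B | U B /\ B x] | x in A].

Definition coarse_family U : Prop := coarsely_proper (lebesgue_fun U setT).

Definition is_cover U : Prop := cover U id = setT.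

Definition refines V U : Prop :=
  forall B, V B -> exists2 C, U C & B `<=` C.

Definition trace U A : set (set X) := [set B `&` A | B in U].

(* The members of a refinement of [trace U A] are automatically subsets of
   [A]. *)
Definition Ln (n : int) U A : \bar R :=
  sup_ge0 [set t | (0 <= t)%E /\
    exists V, [/\ refines V (trace U A),
                  (multiplicity V A <= (n + 1)%:~R%:E)%E
                & (t <= lebesgue_number V A)%E]].

End Families.

(* The least integer n >= m satisfying P, or +oo if there is none: a nonempty
   set of integers bounded below contains its infimum. *)
Definition least_int (R : realType) (m : int) (P : int -> Prop) : \bar R :=
  ereal_inf [set (n%:~R)%:E | n in [set n : int | (m <= n) /\ P n]].

Section Dimensions.
Variables (R : realType) (X : metricType R).

Definition asdim : \bar R :=
  least_int R 0 (fun n => forall U_ : nat -> set (set X),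
    (forall k, is_cover (U_ k)) ->
    lebesgue_number (U_ k) setT @[k --> \oo] --> +oo%E ->
    Ln n (U_ k) setT @[k --> \oo] --> +oo%E).

Definition minor_asdim : \bar R :=
  least_int R 0 (fun n => forall U_ : nat -> set (set X),
    (forall k, is_cover (U_ k) /\ finite_set (U_ k)) ->
    lebesgue_number (U_ k) setT @[k --> \oo] --> +oo%E ->
    Ln n (U_ k) setT @[k --> \oo] --> +oo%E).

Definition large_scale_dim : \bar R :=
  least_int R (-1) (fun n => forall U : set (set X),
    finite_set U -> coarse_family U ->
    forall (x0 : X) (A_ : nat -> set X),
      (forall k, A_ k !=set0 /\ is_bounded (A_ k)) ->
      dist_set x0 (A_ k) @[k --> \oo] --> +oo%E ->
      Ln n U (A_ k) @[k --> \oo] --> +oo%E).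

End Dimensions.

(* Main.v *)
Require Import Defs.
From mathcomp Require Import all_boot all_order all_algebra.
From mathcomp Require Import all_classical all_reals all_analysis.
From mathcomp Require Import finmap lra.

(** Write [d] for the metric and [|x|] for the distance from [x] to a fixed
base point. All dimensions become statements about a single family and real
scales: a family has Lebesgue number about [t] when each ball of radius [t]
lies in a member, and [Ln n U A] is large when [U] has on [A] a refinement of
multiplicity at most [n + 1] with large Lebesgue number ([Ln_cvgP]). Both
[asdim] and [minor_asdim] are then instances of one condition
([uniform_dim_le]) about a class [C] of families, and the large scale dimension
is a condition on the tails [|x| >= r] ([tail_dim_le]).

The large scale dimension is the smaller one. To refine a finite coarse family
[U] on a bounded set [A] far from the base point, add a big ball that misses
[A] to every member of [U]. The result covers [X] with a large Lebesgue number
and has the same trace on [A] as [U], so refinements of it restrict to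
refinements of [U] on [A] ([uniform_tail_dim_le]).

Conversely, let some [N] bound the dimension for [C] and let [n] satisfy the
large scale condition ([uniform_dim_le_descend]). Given a family [U] in [C] with
a huge Lebesgue number, one first cuts each member into a part near the base
point and a part away from it, then refines to multiplicity [N + 1]. Such a
refinement can be improved to [N + 1] colours, the sets of each colour being
far apart ([colouring]). The unions [W 0, ..., W N] of the colours are a cover
with a number of members that does not depend on the scale, which is where the
finiteness of the dimension enters.

For covers with [N + 1] members the large scale condition has a uniform form:
given [t] there is [s] such that every such cover of Lebesgue number [s] can be
shrunk on [|x| >= s] to multiplicity [n + 1] and Lebesgue number [t]
([tail_dim_le_shrinks]). Otherwise there are bad covers for arbitrarily large
[s]; by an ultrafilter argument each is already bad on an annulus
[s <= |x| < R] ([shrinks_compact]). Choosing the next [s] far beyond the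
previous [R] makes the annuli disjoint and further and further apart, so the bad
covers can be glued to one coarse family of [N + 1] sets, contradicting the
large scale condition.

Finally the shrunk cover is cut along the sets of each colour, which does not
raise the multiplicity as these are disjoint and keeps the Lebesgue number as
they are far apart ([shrinks_refinable]). It refines [U] but exists only on
[|x| >= s]. A ball around the base point is added, together with all the sets
meeting it; since each of them lies in the near part of a member of [U], the
union lies in a fixed ball, hence in one member of [U]. Absorbing sets in this
way does not raise the multiplicity ([order_le_absorb]).

It remains to exclude [n = -1], which is where [X] must be unbounded. *)

Set Implicit Arguments.
Unset Strict Implicit.
Unset Printing Implicit Defensive.

Import Order.TTheory GRing.Theory Num.Theory.

Local Open Scope card_scope.
Local Open Scope classical_set_scope.
Local Open Scope ring_scope.

(** * Lebesgue numbers and multiplicity at a real scale *)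

Section Dictionary.
Variables (R : realType) (X : metricType R).
Implicit Types (A : set X) (U V : set (set X)) (t : R) (n : nat).

(** Up to an arbitrarily small loss in [t] this says that the Lebesgue number is
at least [t]; the supremum that defines it need not be attained. *)
Definition lebesgue_ge V A t : Prop :=
  forall x, A x -> exists2 B, V B & forall y, A y -> mdist x y < t -> B y.

Definition order_le n V A : Prop :=
  forall x, A x -> [set B | V B /\ B x] #<= `I_n.+1.

Definition refinable n U A t : Prop :=
  exists V, [/\ refines V U, order_le n V A & lebesgue_ge V A t].

Lemma lebesgue_ge_number V A t :
  lebesgue_ge V A t -> (t%:E <= lebesgue_number V A)%E.
Proof.
move=> VAt; apply: le_ereal_inf_tmp => _ [x Ax <-].
have [B VB xB] := VAt x Ax.
rewrite /lebesgue_fun /sup_ge0 le_max; apply/orP; right.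
apply: le_ereal_sup_tmp; exists (dist_set x (A `\` B)); first by exists B.
apply: le_ereal_inf_tmp => _ [y [Ay nBy] <-].
by rewrite lee_fin leNgt; apply/negP => /(xB y Ay).
Qed.

Lemma lebesgue_fun_gt V A t x : 0 <= t -> (t%:E < lebesgue_fun V A x)%E ->
  exists2 B, V B & forall y, A y -> mdist x y < t -> B y.
Proof.
move=> t0; rewrite /lebesgue_fun /sup_ge0 lt_max lte_fin (le_gtF t0)/=.
move=> /ereal_sup_gt[_ [B VB <-] tB]; exists B => // y Ay xyt.
apply: contrapT => nBy; move: tB; apply/negP; rewrite -leNgt.
apply: (@le_trans _ _ (mdist x y)%:E); last by rewrite lee_fin ltW.
by apply: ereal_inf_lbound; exists y.
Qed.

Lemma lebesgue_number_ge V A t : 0 <= t -> (t%:E < lebesgue_number V A)%E ->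
  lebesgue_ge V A t.
Proof.
move=> t0 tV x Ax; apply: lebesgue_fun_gt => //.
by apply: (lt_le_trans tV); apply: ereal_inf_lbound; exists x.
Qed.

Lemma multiplicity_leP n V A :
  (multiplicity V A <= (n%:Z + 1)%:~R%:E :> \bar R)%E <-> order_le n V A.
Proof.
have -> : ((n%:Z + 1)%:~R : R) = n.+1%:R by rewrite intrD mulr1z -pmulrn natr1.
rewrite /multiplicity /sup_ge0 ge_max lee_fin ler0n/=; split.
  move=> VA x Ax.
  have : (counting [set B | V B /\ B x] <= n.+1%:R%:E :> \bar R)%E.
    by apply: le_trans VA; apply: ereal_sup_ubound; exists x.
  rewrite /counting; case: asboolP => // fin; rewrite lee_fin ler_nat => le_n.
  have [k kE] := (finite_setP _).1 fin.
  rewrite (card_fset_set kE) in le_n.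
  by rewrite (card_le_eql kE) card_le_II.
move=> VA; apply: ge_ereal_sup => _ [x Ax <-].
have xn := VA x Ax; have fin : finite_set [set B | V B /\ B x].
  exact: card_le_finite xn _.
by rewrite /counting asboolT// lee_fin ler_nat geq_card_fset_set.
Qed.

Lemma order_le_trace n V A A' : A' `<=` A -> order_le n V A ->
  order_le n (trace V A') A'.
Proof.
move=> A'A VA x A'x; apply: card_le_trans (VA x (A'A x A'x)).
apply: (@card_le_trans _ _ _
  ((fun B => B `&` A') @` [set B | V B /\ B x])); last exact: card_image_le.
by apply: subset_card_le => _ [[B VB <-] [Bx _]]; exists B.
Qed.

Lemma lebesgue_ge_trace V A A' t : A' `<=` A -> lebesgue_ge V A t ->
  lebesgue_ge (trace V A') A' t.
Proof.
move=> A'A VA x A'x; have [B VB xB] := VA x (A'A x A'x).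
exists (B `&` A'); first by exists B.
by move=> y A'y xy; split => //; apply: xB => //; apply: A'A.
Qed.

Lemma refinable_Ln n U A t : 0 <= t -> refinable n U A t ->
  (t%:E <= Ln n U A)%E.
Proof.
move=> t0 [V [VU Vn Vt]]; rewrite /Ln /sup_ge0 le_max; apply/orP; right.
apply: ereal_sup_ubound; split; first by rewrite lee_fin.
exists (trace V A); split.
- move=> _ [B VB <-]; have [C UC BC] := VU B VB.
  by exists (C `&` A); [exists C|exact: setSI].
- exact/multiplicity_leP/(order_le_trace _ Vn).
- exact/lebesgue_ge_number/(lebesgue_ge_trace _ Vt).
Qed.

Lemma Ln_refinable n U A t : 0 <= t -> (t%:E < Ln n U A)%E ->
  refinable n U A t.
Proof.
move=> t0; rewrite /Ln /sup_ge0 lt_max lte_fin (le_gtF t0)/=.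
move=> /ereal_sup_gt[s [_ [V [VU Vn sV]]] ts]; exists V; split.
- move=> B /VU[_ [C UC <-] BC]; exists C => //.
  by apply: subset_trans BC _; exact: subIsetl.
- exact/multiplicity_leP.
- by apply: lebesgue_number_ge => //; apply: lt_le_trans ts sV.
Qed.

Lemma Ln_cvgP n (U_ : nat -> set (set X)) (A_ : nat -> set X) :
  Ln n (U_ k) (A_ k) @[k --> \oo] --> +oo%E <->
  forall t, 0 < t -> \forall k \near \oo, refinable n (U_ k) (A_ k) t.
Proof.
split=> [/cvgeyPgt Ut t t0|Ut].
  by apply: filterS (Ut t) => k; apply: Ln_refinable; exact: ltW.
apply/cvgeyPge => t.
have t0 : 0 < Num.max t 1 by rewrite lt_max ltr01 orbT.
apply: filterS (Ut _ t0) => k /(refinable_Ln (ltW t0)); apply: le_trans.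
by rewrite lee_fin le_max lexx.
Qed.

Lemma lebesgue_number_cvgP (U_ : nat -> set (set X)) :
  lebesgue_number (U_ k) setT @[k --> \oo] --> +oo%E <->
  forall t, 0 < t -> \forall k \near \oo, lebesgue_ge (U_ k) setT t.
Proof.
split=> [/cvgeyPgt Ut t t0|Ut].
  by apply: filterS (Ut t) => k; apply: lebesgue_number_ge; exact: ltW.
apply/cvgeyPge => t.
have t0 : 0 < Num.max t 1 by rewrite lt_max ltr01 orbT.
apply: filterS (Ut _ t0) => k /lebesgue_ge_number; apply: le_trans.
by rewrite lee_fin le_max lexx.
Qed.

End Dictionary.

(** * The dimensions as conditions on single families *)

Section Uniform.
Variables (R : realType) (X : metricType R).
Implicit Types (A : set X) (U V : set (set X)) (t r s : R) (n : nat).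
Implicit Types C : set (set X) -> Prop.

(** With [C] the class of all families, resp. of the finite ones, these are the
conditions that [asdim X], resp. [minor_asdim X], minimizes over [0 <= n]. *)
Definition seq_dim_le C (n : int) : Prop :=
  forall U_ : nat -> set (set X), (forall k, is_cover (U_ k) /\ C (U_ k)) ->
    lebesgue_number (U_ k) setT @[k --> \oo] --> +oo%E ->
    Ln n (U_ k) setT @[k --> \oo] --> +oo%E.

Definition large_seq_dim_le (n : int) : Prop :=
  forall U, finite_set U -> coarse_family U ->
    forall (x0 : X) (A_ : nat -> set X),
      (forall k, A_ k !=set0 /\ is_bounded (A_ k)) ->
      dist_set x0 (A_ k) @[k --> \oo] --> +oo%E ->
      Ln n U (A_ k) @[k --> \oo] --> +oo%E.

Definition uniform_dim_le C n : Prop :=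
  forall t, 0 < t -> exists2 s, 0 < s & forall U, C U ->
    lebesgue_ge U setT s -> refinable n U setT t.

Definition coarse_at (x0 : X) U : Prop :=
  forall t, 0 < t -> exists r, forall x, r <= mdist x0 x ->
    exists2 B, U B & forall y, mdist x y < t -> B y.

Definition tail_dim_le (x0 : X) n : Prop :=
  forall U, finite_set U -> coarse_at x0 U -> forall t, 0 < t ->
    exists r, forall A, is_bounded A -> (forall a, A a -> r <= mdist x0 a) ->
      refinable n U A t.

Lemma lebesgue_geW V A s t : s <= t -> lebesgue_ge V A t -> lebesgue_ge V A s.
Proof.
move=> st VA x Ax; have [B VB xB] := VA x Ax; exists B => // y Ay xy.
exact/xB/(lt_le_trans xy).
Qed.

Lemma lebesgue_ge_cover U t : 0 < t -> lebesgue_ge U setT t -> is_cover U.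
Proof.
move=> t0 Ut; apply/seteqP; split => // x _.
by have [B UB xB] := Ut x I; exists B => //; apply: xB; rewrite ?mdistxx.
Qed.

(** By contraposition: if no scale [s] works for [t], the bad families taken at
the scales 1, 2, 3, ... form a sequence that violates the sequential
condition. *)
Lemma uniform_dim_leP C n : seq_dim_le C n <-> uniform_dim_le C n.
Proof.
split=> [dimP t t0|dimP U_ CU /lebesgue_number_cvgP U_t].
  apply: contrapT => /forall2NP no_s.
  have /choice[U_ U_P] k : exists U, [/\ C U, lebesgue_ge U setT k.+1%:R
      & ~ refinable n U setT t].
    have [//|/existsNP[U /not_implyP[CU /not_implyP[Us nU]]]] := no_s k.+1%:R.
    by exists U.
  have : Ln n (U_ k) setT @[k --> \oo] --> +oo%E.
    apply: dimP => [k|].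
      by have [CU Uk _] := U_P k; split => //; apply: lebesgue_ge_cover Uk.
    apply/lebesgue_number_cvgP => s s0.
    apply: filterS (nbhs_infty_ger s) => k sk; have [_ Uk _] := U_P k.
    by apply: lebesgue_geW Uk; rewrite (le_trans sk)// ler_nat.
  move=> /Ln_cvgP/(_ t t0)/filter_ex[k].
  by have [_ _] := U_P k.
apply/Ln_cvgP => t /dimP[s s0 Us].
by apply: filterS (U_t s s0) => k; apply: Us; have [] := CU k.
Qed.

Lemma coarse_atP (x0 : X) U : coarse_family U <-> coarse_at x0 U.
Proof.
split=> [cU t t0|cU x_ [x1 x1oo]].
  apply: contrapT => /forallNP no_r.
  have /choice[x_ x_P] (k : nat) : exists x, k%:R <= mdist x0 x /\
      ~ exists2 B, U B & forall y, mdist x y < t -> B y.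
    by have /existsNP[x /not_implyP] := no_r k%:R; exists x.
  have x_oo : to_infinity x_.
    exists x0; apply/cvgryPge => s; apply: filterS (nbhs_infty_ger s) => k sk.
    by rewrite metric_sym (le_trans sk)//; have [] := x_P k.
  have /cvgeyPgt/(_ t)/filter_ex[k] := cU x_ x_oo.
  move=> /(lebesgue_fun_gt (ltW t0))[B UB xB].
  by have [_ []] := x_P k; exists B => // y; apply: xB.
apply/cvgeyPge => t.
have t0 : 0 < Num.max t 1 by rewrite lt_max ltr01 orbT.
have [r cr] := cU _ t0.
move/cvgryPge: x1oo => /(_ (r + mdist x0 x1)); apply: filterS => k rk.
have rx : r <= mdist x0 (x_ k).
  have := metric_triangle (x_ k) x0 x1; rewrite (metric_sym (x_ k) x0); lra.
have [B UB xB] := cr _ rx.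
rewrite /lebesgue_fun /sup_ge0 le_max; apply/orP; right.
apply: le_ereal_sup_tmp; exists (dist_set (x_ k) (setT `\` B)).
  by exists B.
apply: le_ereal_inf_tmp => _ [y [_ nBy] <-].
rewrite lee_fin leNgt; apply/negP => xy; apply/nBy/xB.
by rewrite lt_max xy.
Qed.

Lemma refinable0 n U t : refinable n U set0 t.
Proof. by exists set0; split. Qed.

Lemma large_seq_tail_dim_le (x0 : X) n :
  large_seq_dim_le n -> tail_dim_le x0 n.
Proof.
move=> dimP U finU /coarse_atP cU t t0.
apply: contrapT => /forallNP no_r.
have /choice[A_ A_P] (k : nat) : exists A, [/\ is_bounded A,
    forall a, A a -> k%:R <= mdist x0 a & ~ refinable n U A t].
  have /existsNP[A /not_implyP[bA /not_implyP[kA nA]]] := no_r k%:R.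
  by exists A.
have : Ln n U (A_ k) @[k --> \oo] --> +oo%E.
  apply: (dimP _ finU cU x0).
    move=> k; have [bA _ nA] := A_P k; split => //.
    apply/set0P/eqP => A0; apply: nA; rewrite A0; exact: refinable0.
  apply/cvgeyPge => s; apply: filterS (nbhs_infty_ger s) => k sk.
  apply: le_ereal_inf_tmp => _ [a Aa <-]; rewrite lee_fin (le_trans sk)//.
  by have [_ + _] := A_P k; apply.
by move=> /Ln_cvgP/(_ t t0)/filter_ex[k]; have [_ _] := A_P k.
Qed.

Lemma tail_large_seq_dim_le n :
  (forall x0, tail_dim_le x0 n) -> large_seq_dim_le n.
Proof.
move=> dimP U finU cU x0 A_ bA Aoo; apply/Ln_cvgP => t t0.
have [r rP] := dimP x0 U finU ((coarse_atP x0 U).1 cU) t t0.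
move/cvgeyPge: Aoo => /(_ r); apply: filterS => k rk.
apply: rP; first by have [] := bA k.
move=> a Aa; rewrite -lee_fin (le_trans rk)//.
by apply: ereal_inf_lbound; exists a.
Qed.

(** Adding the ball [B0] to the members of [U] repairs the lack of large
members near [x0], and goes unnoticed on sets [A] disjoint from [B0]. *)
Lemma uniform_tail_dim_le C (x0 : X) n : (forall U, finite_set U -> C U) ->
  uniform_dim_le C n -> tail_dim_le x0 n.
Proof.
move=> Cfin dimP U finU cU t /dimP[s s0 dims].
have [r0 r0P] := cU s s0.
exists (r0 + s) => A _ Afar.
have [->|/set0P[a Aa]] := eqVneq A set0; first exact: refinable0.
pose B0 : set X := [set y | mdist x0 y < r0 + s].
pose W := [set D `|` B0 | D in U].
have Ws : lebesgue_ge W setT s.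
  move=> x _; have [rx|xr] := leP r0 (mdist x0 x).
    have [B UB xB] := r0P x rx.
    by exists (B `|` B0); [exists B|move=> y _ xy; left; apply: xB].
  have [|B UB _] := r0P a; first by have := Afar a Aa; lra.
  exists (B `|` B0); first by exists B.
  move=> y _ xy; right; rewrite /B0/=.
  by have := metric_triangle x0 x y; lra.
have [V [VW Vn Vt]] := dims W (Cfin _ (finite_image _ finU)) Ws.
exists (trace V A); split.
- move=> _ [B /VW[_ [D UD <-] BD] <-]; exists D => //.
  move=> y [/BD[//|B0y] /Afar]; move: B0y; rewrite /B0/=; lra.
- exact: order_le_trace Vn.
- exact: lebesgue_ge_trace Vt.
Qed.

End Uniform.

(** * Colourings of families of bounded multiplicity *)

Lemma stationary_chain (T : choiceType) (S : nat -> set T) (N : nat) :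
  (forall j, S j.+1 `<=` S j) -> S 0%N #<= `I_N.+1 -> S N.+1 !=set0 ->
  exists2 j, (j <= N)%N & S j = S j.+1.
Proof.
move=> Sdecr S0 [z SNz]; apply: contrapT => no_j.
have Sfin j : finite_set (S j).
  elim: j => [|j]; first exact: card_le_finite S0 _.
  exact: sub_finite_set.
have card_S j : (j <= N.+1)%N -> (#|` fset_set (S j)|%fset + j <= N.+1)%N.
  elim: j => [|j ih] jN; first by rewrite addn0 geq_card_fset_set.
  rewrite addnS (leq_trans _ (ih (ltnW jN)))// ltn_add2r.
  apply: fproper_ltn_card; rewrite fproperEneq; apply/andP; split; last first.
    by rewrite -fset_set_sub.
  apply: contra_notN no_j => /eqP /fset_set_inj SE.
  by exists j => //; rewrite SE.
have := card_S _ (leqnn _); rewrite -[leqRHS]add0n leq_add2r leqn0.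
rewrite cardfs_eq0 => /eqP /fset_set_set0 SN0.
by move: SNz; rewrite SN0.
Qed.

Section Colouring.
Variables (R : realType) (X : metricType R).
Implicit Types (A P : set X) (U V F : set (set X)) (t s : R) (n N : nat).

Definition separated F s : Prop :=
  forall B C x y, F B -> F C -> B x -> C y -> mdist x y < s -> B = C.

(** To [x] and a radius [a] attach [deep a x], the set of members of [V] that
contain the ball of radius [a] around [x]. It shrinks as [a] grows; between the
[N + 2] radii [b 0 < ... < b N.+1] it takes nonempty values of at most [N + 1]
elements, so it is constant between some [b j] and [b j.+1]. This [j] is
the colour, and the value [S] of [deep] there indexes the set [E j S] of that
colour containing [x]. As moving [x] by less than [s] changes [deep] by no more
than changing the radius by [s], two points within [s] of each other in sets of
the same colour have the same [S]. *)
Lemma colouring N V s : 0 < s -> order_le N V setT ->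
  lebesgue_ge V setT ((3 * N + 4)%:R * s) ->
  exists F : 'I_N.+1 -> set (set X),
    [/\ forall i, refines (F i) V, forall i, separated (F i) s &
      forall x, exists i, exists2 B, F i B & forall y, mdist x y < s -> B y].
Proof.
move=> s0 VN Vs.
pose deep a x := [set B | V B /\ forall y, mdist x y < a -> B y].
have deepS a x b y : mdist x y + b <= a -> deep a x `<=` deep b y.
  move=> ab B [VB xB]; split => // z yz; apply: xB.
  by have := metric_triangle x y z; lra.
have deepW a b x : b <= a -> deep a x `<=` deep b x.
  by move=> ab; apply: deepS; rewrite mdistxx add0r.
pose b (j : nat) := (3 * j%:R + 1) * s.
have bS j : b j.+1 = b j + 3 * s by rewrite /b -natr1; lra.
have b_ge j : s <= b j.
  rewrite /b -[leLHS]mul1r ler_pM2r// lerDr mulr_ge0//.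
pose E (j : nat) (S : set (set X)) :=
  [set x | deep (b j + s) x = S /\ deep (b j + 2 * s) x = S].
(* [E j S] uses only the middle third of the interval from [b j] to [b j.+1]:
   the outer thirds leave room for a ball of radius [s] around [x]. *)
exists (fun i => [set E i S | S in [set S | S `<=` V /\ S !=set0]]); split.
- move=> i _ [S [SV [B SB]] <-]; exists B; first exact: SV.
  move=> x [_]; move: SB => /[swap] <- [_]; apply.
  by rewrite mdistxx; have := b_ge i; lra.
- move=> i _ _ x y [S _ <-] [S' _ <-] [xS1 xS2] [yS1 yS2] xy.
  suff -> : S = S' by [].
  apply/seteqP; split.
    by rewrite -xS2 -yS1; apply: deepS; lra.
  by rewrite -xS1 -yS2; apply: deepS; rewrite metric_sym; lra.
- move=> x.
  have [j jN bj] : exists2 j, (j <= N)%N & deep (b j) x = deep (b j.+1) x.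
    apply: (@stationary_chain _ (fun j => deep (b j) x)).
    + by move=> j; apply: deepW; rewrite bS; lra.
    + apply: card_le_trans (VN x I); apply: subset_card_le => B [VB xB].
      by split => //; apply: xB; rewrite mdistxx; have := b_ge 0%N; lra.
    + have [B VB xB] := Vs x I; exists B; split => // y xy; apply: xB => //.
      apply: (lt_le_trans xy); rewrite /b ler_pM2r// -natr1 natrD natrM; lra.
  exists (inord j), (E j (deep (b j) x)) => /=.
    exists (deep (b j) x); last by rewrite inordK.
    split; first by move=> B [].
    rewrite bj; have [B VB xB] := Vs x I; exists B; split => // y xy.
    apply: xB => //; apply: (lt_le_trans xy); rewrite /b ler_pM2r//.
    rewrite natrD natrM -natr1.
    have : (j%:R : R) <= N%:R by rewrite ler_nat.
    lra.
  move=> y xy; split; apply/seteqP; split.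
  + by apply: deepS; rewrite metric_sym; lra.
  + by rewrite bj; apply: deepS; rewrite bS; lra.
  + by apply: deepS; rewrite metric_sym; lra.
  + by rewrite bj; apply: deepS; rewrite bS; lra.
Qed.

End Colouring.

(** * Shrinking covers with a fixed number of members *)

Section Shrinking.
Variables (R : realType) (X : metricType R).
Implicit Types (A : set X) (t : R) (n N : nat).

(** Keeping the index set of [W] makes refinements of bounded multiplicity a
compact notion: for each point only finitely many membership patterns are
possible. *)
Definition shrinks n N (W : 'I_N.+1 -> set X) A t : Prop :=
  exists V : 'I_N.+1 -> set X,
    [/\ forall i, V i `<=` W i,
        forall x, A x -> [set i | V i x] #<= `I_n.+1 &
        forall x, A x -> exists i, forall y, A y -> mdist x y < t -> V i y].

(** Assign to each member of a refinement one [W i] containing it and unite the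
members with the same [i]. *)
Lemma refinable_shrinks n N (W : 'I_N.+1 -> set X) A t :
  refinable n (range W) A t -> shrinks n W A t.
Proof.
move=> [V [VW Vn Vt]].
have /choice[g gP] B : exists i, V B -> B `<=` W i.
  by have [/VW[_ [i _ <-] BW]|nVB] := pselect (V B); [exists i|exists ord0].
exists (fun i => [set x | exists2 B, V B /\ g B = i & B x]); split.
- by move=> i x [B [VB <-]]; apply: gP.
- move=> x Ax; apply: card_le_trans (Vn x Ax).
  apply: card_le_trans (card_image_le g _); apply: subset_card_le.
  by move=> i [B [VB gB] Bx]; exists B.
- move=> x Ax; have [B VB xB] := Vt x Ax; exists (g B) => y Ay xy.
  by exists B => //; apply: xB.
Qed.

(** The limit of the shrinkings on balls along an ultrafilter on the radii is a
shrinking on all of [A]: an ultrafilter that contains a finite union contains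
one of its terms, so the index that serves a point [x] can be chosen
independently of the radius. *)
Lemma shrinks_compact n N (W : 'I_N.+1 -> set X) A t (x0 : X) :
  (forall k : nat, shrinks n W (A `&` [set x | mdist x0 x < k%:R]) t) ->
  shrinks n W A t.
Proof.
move=> /choice[V_ V_P].
have [G [GU Goo]] := @ultraFilterLemma _ \oo%classic _.
have Gball x : \forall k \near G, mdist x0 x < k%:R.
  by apply: Goo; apply: nbhs_infty_gtr.
exists (fun i => [set x | \forall k \near G, V_ k i x]); split.
- move=> i x /filter_ex[k]; have [VW _ _] := V_P k; exact: VW.
- move=> x Ax.
  have : \forall k \near G, forall i, (\forall l \near G, V_ l i x) -> V_ k i x.
    apply: filter_forall => i.
    have [Vi|nVi] := pselect (\forall l \near G, V_ l i x).
      by apply: filterS Vi.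
    by apply: filterE => k /nVi.
  move=> /(filterI (Gball x))/filter_ex[k [xk Vk]].
  have [_ Vn _] := V_P k.
  by apply: card_le_trans (Vn x _); [exact: subset_card_le|split].
- move=> x Ax.
  pose Q i k := forall y, A y -> mdist x0 y < k%:R -> mdist x y < t -> V_ k i y.
  have [i Qi] : exists i, \forall k \near G, Q i k.
    apply: contrapT => /forallNP noi.
    have : \forall k \near G, forall i, ~ Q i k.
      apply: filter_forall => i.
      by have [/noi|] := in_ultra_setVsetC [set k | Q i k] GU.
    move=> /(filterI (Gball x))/filter_ex[k [xk nQ]].
    have [_ _ /(_ x (conj Ax xk))[i iP]] := V_P k.
    by apply: (nQ i) => y Ay yk; apply: iP.
  exists i => y Ay xy; apply: filterS2 Qi (Gball y) => k Qik yk.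
  exact: Qik.
Qed.

End Shrinking.

(** * Uniformity of shrinking on tails *)

Section Transfer.
Variables (R : realType) (X : metricType R).
Implicit Types (A P : set X) (U V F : set (set X)) (t s r : R) (n N : nat).

(** If no [s] works, there are bad covers [W] for all [s], bad already on the
annuli [zone k] with inner radii [s_ k], each of which lies far beyond the outer
radius of the previous annulus. Gluing these covers, with no condition outside
the annuli, gives a family [U] of [N + 1] sets that is coarse: far from [x0] a
ball of given radius meets at most one annulus, and the Lebesgue number of the
cover used there is larger than the radius. On [zone k] the family [U] agrees
with the bad cover, so it cannot have refinements there. *)
Lemma tail_dim_le_shrinks (x0 : X) n N t : tail_dim_le x0 n -> 0 < t ->
  exists2 s, 0 < s & forall W : 'I_N.+1 -> set X,
    (forall x, exists i, forall y, mdist x y < s -> W i y) ->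
    shrinks n W [set x | s <= mdist x0 x] t.
Proof.
move=> dimP t0; apply: contrapT => /forall2NP no_s.
have /choice[w w_P] s : exists w : ('I_N.+1 -> set X) * nat, 0 < s ->
    (forall x, exists i, forall y, mdist x y < s -> w.1 i y) /\
    ~ shrinks n w.1 ([set x | s <= mdist x0 x] `&`
                     [set x | mdist x0 x < w.2%:R]) t.
  have [//|/existsNP[W /not_implyP[Ws nW]]] := no_s s.
    by exists (fun=> setT, 0%N).
  suff [k nk] : exists k : nat, ~ shrinks n W ([set x | s <= mdist x0 x] `&`
      [set x | mdist x0 x < k%:R]) t by exists (W, k).
  by apply: contrapT => /forallNP all_k; apply: nW;
  apply: (@shrinks_compact _ _ _ _ _ _ _ x0) => k; exact: contrapT.
pose s_ (k : nat) : R := iter k (fun s => (w s).2%:R + s + 1) 1.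
have sS k : s_ k.+1 = (w (s_ k)).2%:R + s_ k + 1 by [].
have s_ge k : k%:R + 1 <= s_ k.
  elim: k => [|k ih]; first by rewrite add0r.
  by rewrite sS -natr1; have := ler0n R (w (s_ k)).2; lra.
have s0 k : 0 < s_ k by have := s_ge k; have := ler0n R k; lra.
have s_lt j k : (j < k)%N -> (w (s_ j)).2%:R + s_ j <= s_ k.
  elim: k => // k ih; rewrite ltnS leq_eqVlt => /orP[/eqP ->|/ih jk].
    by rewrite sS; lra.
  by rewrite sS; have := ler0n R (w (s_ k)).2; lra.
have s_le j k : (j <= k)%N -> s_ j <= s_ k.
  rewrite leq_eqVlt => /orP[/eqP -> //|/s_lt]; apply: le_trans.
  by rewrite lerDr.
pose zone k := [set x | s_ k <= mdist x0 x] `&`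
               [set x | mdist x0 x < (w (s_ k)).2%:R].
pose U i := [set x | forall k, zone k x -> (w (s_ k)).1 i x].
have Ucoarse : coarse_at x0 (range U).
  move=> t1 t10.
  have [K t1K] : exists K, 2 * t1 <= s_ K.
    have [K _ /(_ K (leqnn _))/= tK] := nbhs_infty_ger (2 * t1).
    by exists K; have := s_ge K; lra.
  exists ((w (s_ K)).2%:R + s_ K + t1) => x xfar.
  have far y k : mdist x y < t1 -> zone k y -> (K < k)%N.
    move=> xy [_ /= yk]; rewrite ltnNge leq_eqVlt; apply/negP => /orP[/eqP kK|kK].
      by have := metric_triangle x0 y x; rewrite (metric_sym y x);
        move: yk; rewrite kK; have := s0 K; lra.
    have := metric_triangle x0 y x; rewrite (metric_sym y x).
    by have := s_lt _ _ kK; have := s0 k; have := ler0n R (w (s_ K)).2; lra.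
  have [[y [k [xy yk]]]|nozone] :=
    pselect (exists y k, mdist x y < t1 /\ zone k y); last first.
    exists (U ord0); first by exists ord0.
    by move=> y xy k yk; exfalso; apply: nozone; exists y, k.
  have [Ws _] := w_P (s_ k) (s0 k).
  have [i xi] := Ws x; exists (U i); first by exists i.
  have apart j l y1 y2 : mdist x y1 < t1 -> mdist x y2 < t1 ->
      zone j y1 -> zone l y2 -> ~ (j < l)%N.
    move=> xy1 xy2 jy1 ly2 /s_lt jl; move: (jy1) (ly2) => [_ /= y1j] [/= ly _].
    have := s_le _ _ (ltnW (far _ _ xy1 jy1)).
    have := metric_triangle x0 y1 y2; have := metric_triangle y1 x y2.
    by rewrite (metric_sym y1 x); lra.
  move=> z xz l lz; have -> : l = k.
    apply/eqP; rewrite eqn_leq; apply/andP; split; rewrite leqNgt; apply/negP.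
      exact: apart yk lz.
    exact: apart lz yk.
  apply: xi; apply: (lt_le_trans xz).
  by have := s_le _ _ (ltnW (far _ _ xy yk)); lra.
have [r rP] := dimP _ (finite_image _ finite_finset) Ucoarse t t0.
have [k _ /(_ k (leqnn _))/= rk] := nbhs_infty_ger r.
have [_] := w_P (s_ k) (s0 k); apply.
have [|V [VU Vn Vt]] := @refinable_shrinks _ _ n N U (zone k) t.
  apply: rP.
    exists (2 * (w (s_ k)).2%:R) => x y [_ /= xk] [_ /= yk].
    by have := metric_triangle x x0 y; rewrite (metric_sym x x0); lra.
  by move=> a [/= ak _]; have := s_ge k; lra.
exists (fun i => V i `&` zone k); split.
- by move=> i x [/VU]; apply.
- move=> x kx; apply: card_le_trans (Vn x kx).
  by apply: subset_card_le => i [].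
- move=> x kx; have [i iP] := Vt x kx; exists i => y ky xy.
  by split => //; apply: iP.
Qed.

(** * Cutting along colours and absorbing into a ball *)

(** A set [V i] of the shrinking is replaced by its intersections with the sets
of colour [i]. Disjointness of these keeps the multiplicity. A ball of radius
[t <= s] inside [V i] meets only one of them, by separation, so it stays inside
one of the new sets. *)
Lemma shrinks_refinable n N (F : 'I_N.+1 -> set (set X)) U A s t :
  (forall i, refines (F i) U) -> (forall i, separated (F i) s) ->
  0 < t -> t <= s -> shrinks n (fun i => \bigcup_(B in F i) B) A t ->
  exists V, [/\ refines V U, order_le n V setT, lebesgue_ge V A t &
                forall B, V B -> B `<=` A].
Proof.
move=> FU Fs t0 ts [V [VF Vn Vt]].
exists [set B | exists i C, F i C /\ B = V i `&` C `&` A]; split.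
- move=> _ [i [C [FC ->]]]; have [D UD CD] := FU i C FC.
  by exists D => // x [[_ /CD]].
- move=> x _; have [Ax|nAx] := pselect (A x); last first.
    rewrite (_ : mkset _ = set0); first exact: card_ge0.
    by apply/seteqP; split => // _ [[i [C [_ ->]]] [_ /nAx]].
  apply: card_le_trans (Vn x Ax).
  pose piece i := \bigcup_(C in [set C | F i C /\ C x]) C.
  apply: card_le_trans (card_image_le (fun i => V i `&` piece i `&` A) _).
  apply: subset_card_le => _ [[i [C [FC ->]]] [[Vx Cx] _]]; exists i => //=.
  congr (_ `&` _ `&` _); apply/seteqP; split => y; last by exists C.
  move=> [C' [FC' C'x] C'y].
  by rewrite (Fs i C C' x x FC FC' Cx C'x)// mdistxx (lt_le_trans t0).
- move=> x Ax; have [i xi] := Vt x Ax.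
  have [|C FC Cx] := VF i x; first by apply: xi; rewrite ?mdistxx.
  exists (V i `&` C `&` A); first by exists i, C.
  move=> y Ay xy; split => //; split; first exact: xi.
  have [C' FC' C'y] := VF i y (xi y Ay xy).
  by rewrite (Fs i C C' x y FC FC' Cx C'y)// (lt_le_trans xy).
- by move=> _ [i [C [_ ->]]] x [].
Qed.

Definition absorb V P : set X :=
  P `|` \bigcup_(B in [set B | V B /\ B `&` P !=set0]) B.

(** A point of [P] lies only in [absorb V P], as all other remaining sets miss
[P]. A point of [absorb V P] outside [P] lies in some absorbed set, which
accounts for the new one. *)
Lemma order_le_absorb n V P : order_le n V setT ->
  order_le n (absorb V P |` [set B | V B /\ B `&` P = set0]) setT.
Proof.
move=> Vn x _; have [Px|nPx] := pselect (P x).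
  apply: (@card_le_trans _ _ _ `I_1); last by rewrite card_le_II.
  rewrite (_ : mkset _ = [set absorb V P]).
    by rewrite (card_le_eql card_set1).
  apply/seteqP; split => [B [[//|[_ BP]] Bx]|_ ->].
    by have : set0 x by rewrite -BP.
  by split; left.
apply: card_le_trans (Vn x I).
pose g B := if pselect (B `&` P = set0) then B else absorb V P.
apply: card_le_trans (card_image_le g _); apply: subset_card_le.
move=> D [[->|[VD DP]] Dx].
  case: Dx => // -[B [VB BP] Bx]; exists B => //; rewrite /g; case: pselect => //.
  by move=> BP0; exfalso; case: BP => z; rewrite BP0.
by exists D => //; rewrite /g; case: pselect.
Qed.

(** * From tails to the whole space *)

(** The splitting condition on [C] allows cutting the members of [U] into the
parts in [near] and in [far]. The two overlap in the shell [q <= |x| < r], of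
width [2 * s2], so the Lebesgue number stays at least [s2]; and a subset of a
part that reaches into the ball of radius [q] must lie in [near]. *)
Lemma uniform_dim_le_descend (C : set (set X) -> Prop) (x0 : X) n N :
  (forall U P Q, C U ->
     C ([set B `&` P | B in U] `|` [set B `&` Q | B in U])) ->
  uniform_dim_le C N -> tail_dim_le x0 n -> uniform_dim_le C n.
Proof.
move=> Csplit dimN dimn t t0.
have [s1 s10 s1P] := tail_dim_le_shrinks N dimn t0.
pose s := Num.max s1 t.
have s1s : s1 <= s by rewrite le_max lexx.
have ts : t <= s by rewrite le_max lexx orbT.
have s0 : 0 < s by apply: lt_le_trans ts.
have [|s2 s20 s2P] := dimN ((3 * N + 4)%:R * s).
  by rewrite mulr_gt0// ltr0n addnS.
(* A ball of radius [t] centred in [|x| < s1 + t] stays within [|x| < q]. All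
   other balls of radius [t] avoid [|x| < s1], where no shrinking is known. *)
pose q := s1 + 2 * t; pose r := q + 2 * s2.
pose near := [set x | mdist x0 x < r]; pose far := [set x | q <= mdist x0 x].
exists r; first by rewrite /r /q; lra.
move=> U CU Ur.
pose U' := [set B `&` near | B in U] `|` [set B `&` far | B in U].
have U's : lebesgue_ge U' setT s2.
  move=> x _; have [B UB xB] := Ur x I.
  have [xq|qx] := ltP (mdist x0 x) (q + s2).
    exists (B `&` near); first by left; exists B.
    move=> y _ xy; split; first by apply: xB => //; rewrite /r /q; lra.
    by have := metric_triangle x0 x y; rewrite /near/= /r; lra.
  exists (B `&` far); first by right; exists B.
  move=> y _ xy; split; first by apply: xB => //; rewrite /r /q; lra.
  by have := metric_triangle x0 y x; rewrite (metric_sym y x) /far/=; lra.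
have [V0 [V0U' V0N V0s]] := s2P U' (Csplit _ _ _ CU) U's.
have [F [FV0 Fsep Fs]] := colouring s0 V0N V0s.
pose A := [set x | s1 <= mdist x0 x].
have [|||||V [VU' Vn Vt VA]] := @shrinks_refinable n N F U' A s t => //.
- by move=> i B /FV0[D /V0U'[E U'E DE] BD]; exists E => //; apply: subset_trans DE.
- apply: s1P => x; have [i [B FB xB]] := Fs x; exists i => y xy.
  by exists B => //; apply/xB/(lt_le_trans xy).
pose P := [set x | mdist x0 x < q].
exists (absorb V P |` [set B | V B /\ B `&` P = set0]); split.
- have U'U B : U' B -> exists2 D, U D & B `<=` D.
    by move=> [[D UD <-]|[D UD <-]]; exists D => //; apply: subIsetl.
  move=> B [->|[/VU'[D /U'U[E UE DE] BD] _]]; last first.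
    by exists E => //; apply: subset_trans DE.
  have [D UD x0D] := Ur x0 I; exists D => // x [Px|[B' [VB' [z [B'z Pz]]] B'x]].
    by apply: x0D => //; move: Px; rewrite /P/= /r; lra.
  have [_ [[E UE <-]|[E UE <-]] B'E] := VU' B' VB'.
    by have [_ xr] := B'E x B'x; apply: x0D.
  by have [_] := B'E z B'z; move: Pz; rewrite /P /far/=; lra.
- exact: order_le_absorb.
- move=> x _; have [xs|sx] := ltP (mdist x0 x) (s1 + t).
    exists (absorb V P); first by left.
    move=> y _ xy; left; have := metric_triangle x0 x y.
    by rewrite /P/= /q; lra.
  have [|B VB xB] := Vt x; first by rewrite /A/=; lra.
  have {}xB y : mdist x y < t -> B y.
    move=> xy; apply: xB => //.
    by have := metric_triangle x0 y x; rewrite (metric_sym y x) /A/=; lra.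
  have [BP|/set0P BP] := eqVneq (B `&` P) set0.
    by exists B; [right|move=> y _; apply: xB].
  exists (absorb V P); first by left.
  by move=> y _ xy; right; exists B => //; apply: xB.
Qed.

(** A family of multiplicity 0 covers no point, so it has Lebesgue number 0 on
any nonempty set. Unboundedness of [X] supplies bounded nonempty sets going to
infinity, on which even the one-member family [{X}] is then a
counterexample. *)
Lemma not_large_seq_dim_leN1 (x0 : X) : ~ is_bounded [set: X] ->
  ~ large_seq_dim_le X (-1).
Proof.
move=> unbX dimP.
have /choice[x_ x_P] (k : nat) : exists x, k%:R <= mdist x0 x.
  apply: contrapT => /forallNP no_x; apply: unbX; exists (2 * k%:R) => x y _ _.
  have /negP := no_x x; have /negP := no_x y; rewrite -!ltNge.
  by have := metric_triangle x x0 y; rewrite (metric_sym x x0); lra.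
have : Ln (-1) [set setT] [set x_ k] @[k --> \oo] --> +oo%E.
  apply: (dimP _ (finite_set1 _) _ x0).
  - apply/(coarse_atP x0) => t t0; exists 0 => x _; exists setT => //.
  - move=> k; split; first by exists (x_ k).
    by exists 0 => _ _ -> ->; rewrite mdistxx.
  - apply/cvgeyPge => s; apply: filterS (nbhs_infty_ger s) => k sk.
    by apply: le_ereal_inf_tmp => _ [_ -> <-]; rewrite lee_fin (le_trans sk).
move=> /cvgeyPgt/(_ 1)/filter_ex[k].
rewrite /Ln /sup_ge0 lt_max lte_fin (le_gtF ler01)/=.
move=> /ereal_sup_gt[t [_ [V [_ V0 tV]]] t1].
have [B VB Bx] : exists2 B, V B & B (x_ k).
  have /(_ (x_ k) erefl)[B VB xB] := lebesgue_number_ge ler01 (lt_le_trans t1 tV).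
  by exists B => //; apply: xB; rewrite ?mdistxx.
have : (counting [set B | V B /\ B (x_ k)] <= 0%:E :> \bar R)%E.
  move: V0; rewrite addNr mulr0z; apply: le_trans.
  rewrite /multiplicity /sup_ge0 le_max; apply/orP; right.
  by apply: ereal_sup_ubound; exists (x_ k).
rewrite /counting; case: asboolP => // fin; rewrite lee_fin.
rewrite lern0 cardfs_eq0 => /eqP/fset_set_set0 V_0.
by have : set0 B by rewrite -V_0.
Qed.

End Transfer.

(** * Equality of the dimensions *)

Lemma least_int_eq_large_scale_dim (R : realType) (X : metricType R)
    (C : set (set X) -> Prop) :
  ~ is_bounded [set: X] -> (forall U, finite_set U -> C U) ->
  (forall U P Q, C U ->
     C ([set B `&` P | B in U] `|` [set B `&` Q | B in U])) ->
  (least_int R 0 (seq_dim_le C) < +oo)%E ->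
  least_int R 0 (seq_dim_le C) = large_scale_dim X.
Proof.
move=> unbX Cfin Csplit /ereal_inf_lt[_ [[N|N] [N_ge0 dimN] _] _]; last by [].
move/uniform_dim_leP: dimN => dimN.
have [x0 _] : exists x0 : X, True.
  by apply: contrapT => /forallNP noX; apply: unbX; exists 0 => x; have := noX x.
rewrite /large_scale_dim /least_int; congr (ereal_inf (_ @` _)).
apply/seteqP; split => -[n|n] [n_ge dimP].
- split; first exact: le_trans n_ge.
  apply: tail_large_seq_dim_le => x1; apply: uniform_tail_dim_le Cfin _.
  exact/uniform_dim_leP.
- by [].
- split => //; apply/uniform_dim_leP.
  apply: (uniform_dim_le_descend (x0 := x0) Csplit dimN).
  exact: large_seq_tail_dim_le dimP.
- case: n n_ge dimP => [_ dimP|//].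
  by have := not_large_seq_dim_leN1 x0 unbX dimP.
Qed.

Theorem theorem6p9 (R : realType) (X : metricType R)
    (hX : ~ is_bounded [set: X]%classic) :
  ((asdim X < +oo)%E -> asdim X = large_scale_dim X) /\
  ((minor_asdim X < +oo)%E -> minor_asdim X = large_scale_dim X).
Proof.
split; last first.
  apply: least_int_eq_large_scale_dim => // U P Q finU.
  by rewrite finite_setU; split; apply: finite_image.
have -> : asdim X =
    least_int R 0 (seq_dim_le (fun _ : set (set X) => True)).
  congr (least_int _ _ _); apply/funext => n; apply/propext.
  by split=> dimP U_ coverU; apply: dimP => k; have := coverU k; tauto.
exact: (@least_int_eq_large_scale_dim _ _ (fun=> True)).
Qed.
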